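(* Let $\eta\in(0,1)$ be fixed, and let $P$ be sufficiently large in terms of $\eta$. Suppose that $\mathbf h=(h_1,h_2,h_3)\in\mathbb Z^3$ is a coefficient triple with the property that $S_2(P;\mathbf h)>P^\eta$. Then the tuple $\mathbf h$ satisfies one of the following two conditions: (a) for some integers $a$ and $b$ with $a\ne b$ and $1\le a,b\le P$, one has $h_j=a^j-b^j$ $(j=1,2,3)$, in which case $S_2(P;\mathbf h)=4P$; (b) one has $h_j=0$ $(j=1,2,3)$, in which case $S_2(P;\mathbf 0)=2P^2-P$. In particular, if $\mathbf h$ satisfies neither condition (a) nor condition (b), then $S_2(P;\mathbf h)=O(P^\varepsilon)$.
   Context: $P$ denotes a large positive integer. For $\mathbf h=(h_1,h_2,h_3)\in\mathbb Z^3$, $S_2(P;\mathbf h)$ denotes the number of integral solutions $(x_1,x_2,y_1,y_2)$ of the system $$x_1^j+x_2^j-y_1^j-y_2^j=h_j\quad (j=1,2,3),$$ with $1\le x_i,y_i\le P$ $(i=1,2)$. A statement involving $\varepsilon$ is asserted to hold for each $\varepsilon>0$.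
   Formalization: In case (a) the value S_2(P;h)=4P is corrected to 4P−4: for a=2, b=1, h=(1,3,7), the solutions have {x_i}={a,t}, {y_i}={b,t}, with 4 for each t other than a, b and only 2 each for t=a and t=b. *)

(* Defs.v *)
From HB Require Import structures.
From mathcomp Require Import all_boot all_order all_algebra.
From mathcomp Require Import all_classical all_reals all_analysis.

Set Implicit Arguments.
Unset Strict Implicit.
Unset Printing Implicit Defensive.

Import Order.TTheory GRing.Theory Num.Theory.

Local Open Scope ring_scope.

(* A triple (h_1, h_2, h_3) of integers is a function on 'I_3; the index j of
   the system is shifted, so that [h j] with j : 'I_3 is h_(j+1) and goes with
   the power j.+1. *)
Definition triple := {ffun 'I_3 -> int}.

(* The variables range over {0, ..., P}; the value 0 is excluded by the
   conditions [0 < _]. *)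
Definition S2 (P : nat) (h : triple) : nat :=
  #|[set t : 'I_P.+1 * 'I_P.+1 * 'I_P.+1 * 'I_P.+1 |
     let: (x1, x2, y1, y2) := t in
     [&& (0 < x1)%N, (0 < x2)%N, (0 < y1)%N, (0 < y2)%N
       & [forall j : 'I_3,
            x1%:Z ^+ j.+1 + x2%:Z ^+ j.+1 - y1%:Z ^+ j.+1 - y2%:Z ^+ j.+1
            == h j]]]|.

(* The solutions of the system for such an h are those in which
   {x_1, x_2} = {a, t} and {y_1, y_2} = {b, t} as multisets, 1 <= t <= P.
   Each t other than a and b gives 4 of them, while t = a and t = b give only 2
   each, so that their number is 4 (P - 2) + 2 + 2 = 4 P - 4, not 4 P. *)
Definition difference_triple (P : nat) (h : triple) : Prop :=
  exists a b : int,
    [/\ a != b, 1 <= a <= P%:Z, 1 <= b <= P%:Z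
      & forall j : 'I_3, h j = a ^+ j.+1 - b ^+ j.+1].

Definition zero_triple (h : triple) : Prop := forall j : 'I_3, h j = 0.

(* Main.v *)
(* Let e1, e2, e3 be the coefficients of z, z^2, z^3 in the power series
   (1 + x1 z)(1 + x2 z) / ((1 + y1 z)(1 + y2 z)); they are polynomials in h.
   Clearing the denominator gives e1 y1 y2 + e2 (y1 + y2) + e3 = 0, that is,
   (e1 y1 + e2)(e1 y2 + e2) = e2^2 - e1 e3, and the right-hand side is also
   the product of the four differences xi - yj. If e1 and this product are
   nonzero, a solution is determined, up to exchanging x1 and x2, by a divisor
   of a fixed nonzero integer of size O(P^4), and the divisor bound applies. If
   e1 is nonzero and the product vanishes, some xi equals some yj and h is a
   difference triple. If e1 = 0, use 2 (y1 - x1)(y1 - x2) = - h_2 instead. *)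
Require Import Defs.
From HB Require Import structures.
From mathcomp Require Import all_boot all_order all_algebra.
From mathcomp Require Import all_classical all_reals all_analysis.
From mathcomp Require Import zify ring lra.

Import Order.TTheory GRing.Theory Num.Theory.

(** * The divisor bound *)

Lemma size_divisors n : 0 < n ->
  size (divisors n) = \prod_(f <- prime_decomp n) f.2.+1.
Proof.
move=> n_gt0; rewrite /divisors unlock /=.
(* [divisors] folds over the prime decomposition: a factor p ^ e performs e merges, each adding one
   more copy of the length reached before it. *)
elim: (prime_decomp n) => //= -[p e] s <- /=.
set l := foldr _ _ s.
by elim: e => [|e IHe] /=; rewrite ?mul1n // size_merge size_cat size_map IHe
     -mulSnr.
Qed.

(** With q the integer part of e / K, e + 1 <= K (q + 1) <= K 2 ^ q, and q K <= e. *)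
Lemma expSn_le_expn2 K e : e.+1 ^ K <= K ^ K * 2 ^ e.
Proof.
case: K => [|K]; first by rewrite !expn0 mul1n expn_gt0.
have h : e.+1 <= K.+1 * 2 ^ (e %/ K.+1).
  apply: (leq_trans (ltn_ceil e (ltn0Sn K))).
  by rewrite mulnC leq_mul2l ltn_expl.
apply: (@leq_trans ((K.+1 * 2 ^ (e %/ K.+1)) ^ K.+1)); first by rewrite leq_exp2r.
by rewrite expnMn -expnM leq_mul2l leq_exp2l // leq_divM orbT.
Qed.

(** Integer form of d(n) = O(n ^ (1 / K)); real exponents first enter in [S2_subpolynomial]. *)
Lemma divisor_bound K : exists C, forall n, 0 < n -> size (divisors n) ^ K <= C * n.
Proof.
have leq_exp2r' m n e : m <= n -> m ^ e <= n ^ e.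
  by case: e => // e; rewrite leq_exp2r.
(* The successor makes [C] exceed 1 for every [K], so that its powers compare as their exponents
   do. *)
pose C := (K ^ K).+1; exists (C ^ (2 ^ K)) => n n_gt0.
rewrite size_divisors // {2}(prod_prime_decomp n_gt0).
(* A prime p >= 2 ^ K satisfies (e + 1) ^ K <= p ^ e, so that only the primes
   below 2 ^ K cost a factor C. *)
pose c p := if p < 2 ^ K then C else 1.
have cP f : f \in prime_decomp n -> f.2.+1 ^ K <= c f.1 * f.1 ^ f.2.
  case: f => p e /mem_prime_decomp [pp _ _] /=; rewrite /c; case: ltnP => hp.
    apply: leq_trans (expSn_le_expn2 K e) _.
    by rewrite leq_mul ?leqnSn // leq_exp2r' // prime_gt1.
  rewrite mul1n; apply: (@leq_trans ((2 ^ e) ^ K)).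
    by rewrite leq_exp2r' // ltn_expl.
  by rewrite -expnM mulnC expnM leq_exp2r'.
have cle : \prod_(f <- prime_decomp n) c f.1 <= C ^ (2 ^ K).
  rewrite -(big_map fst xpredT c) -/(unzip1 _) -/(primes n) /c -big_mkcond /=.
  rewrite big_const_seq iter_muln_1 leq_exp2l; last first.
    by rewrite ltnS expn_gt0; case: (K).
  rewrite -size_filter -[leqRHS](size_iota 0); apply: uniq_leq_size.
    by rewrite filter_uniq // primes_uniq.
  by move=> p; rewrite mem_filter mem_iota => /andP[].
apply: leq_trans (leq_mul cle (leqnn _)).
rewrite -big_split /= (big_morph (fun m => m ^ K) (fun m n => expnMn m n K) (exp1n K)).
by rewrite big_seq [leqRHS]big_seq; apply: leq_prod.
Qed.

(** * Counting by divisors, and the polynomial identities *)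

Local Open Scope ring_scope.

(** The sign of [u t], the bit [s t] and the divisor [|u t|] of [n] determine [t]; the two booleans
    account for the factor 4. *)
Lemma card_le_divisors (T : finType) (E : {set T}) (u : T -> int) (s : T -> bool)
    (n : nat) : (0 < n)%N ->
  {in E &, injective (fun t => (u t, s t))} ->
  (forall t, t \in E -> (`|u t| %| n)%N) ->
  (#|E| <= 4 * size (divisors n))%N.
Proof.
move=> n_gt0 inj_us u_dvd.
pose g t := ((u t < 0, s t), `|u t|%N).
pose l := [seq (b, d) | b <- enum [set: bool * bool], d <- divisors n].
have -> : (4 * size (divisors n) = size l)%N.
  by rewrite size_allpairs -cardE cardsT card_prod card_bool.
rewrite cardE -(size_map g); apply: uniq_leq_size.
  rewrite map_inj_in_uniq ?enum_uniq // => t t'; rewrite !mem_enum => tE t'E.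
  by rewrite /g => -[sgn ss uu]; apply: inj_us => //; congr pair => //; lia.
move=> _ /mapP[t tE ->]; rewrite mem_enum in tE.
apply/allpairsP; exists ((u t < 0, s t), `|u t|%N).
by rewrite mem_enum inE -dvdn_divisors ?u_dvd.
Qed.

(** Eliminating x2 turns the difference of the sums of squares into 2 (x1 - z1)(x1 - z2). *)
Lemma quadratic_cases (x1 x2 z1 z2 : int) :
  x1 + x2 = z1 + z2 -> x1 ^+ 2 + x2 ^+ 2 = z1 ^+ 2 + z2 ^+ 2 ->
  x1 = z1 /\ x2 = z2 \/ x1 = z2 /\ x2 = z1.
Proof.
move=> e1 e2; have : (x1 - z1) * (x1 - z2) * 2 = 0.
  have ex2 : x2 = z1 + z2 - x1 by lia.
  by rewrite -[RHS](subrr (z1 ^+ 2 + z2 ^+ 2)) -{1}e2 ex2; ring.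
move=> /eqP; rewrite !mulf_eq0 => /orP[/orP[]|//] /eqP e; [left|right]; lia.
Qed.

(* [A], [B / 2] and [C / 6] are the coefficients e1, e2, e3. *)
Lemma factorization (x1 x2 y1 y2 : int)
    (A := x1 + x2 - y1 - y2)
    (h2 := x1 ^+ 2 + x2 ^+ 2 - y1 ^+ 2 - y2 ^+ 2)
    (h3 := x1 ^+ 3 + x2 ^+ 3 - y1 ^+ 3 - y2 ^+ 3)
    (B := A ^+ 2 - h2) (C := A ^+ 3 - 3 * A * h2 + 2 * h3) :
  3 * (2 * A * y1 + B) * (2 * A * y2 + B) = 3 * B ^+ 2 - 2 * A * C.
Proof. by rewrite /C /B /h3 /h2 /A; ring. Qed.

Definition solutions (P : nat) (h : triple) :=
  [set t : 'I_P.+1 * 'I_P.+1 * 'I_P.+1 * 'I_P.+1 |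
     let: (x1, x2, y1, y2) := t in
     [&& (0 < x1)%N, (0 < x2)%N, (0 < y1)%N, (0 < y2)%N
       & [forall j : 'I_3,
            x1%:Z ^+ j.+1 + x2%:Z ^+ j.+1 - y1%:Z ^+ j.+1 - y2%:Z ^+ j.+1
            == h j]]].

Lemma S2E P h : S2 P h = #|solutions P h|.
Proof. by []. Qed.

Lemma forall_ord3 (Q : 'I_3 -> Prop) : (forall j, Q j) <-> [/\ Q 0, Q 1 & Q 2].
Proof.
split=> [//|[q0 q1 q2] [[|[|[|//]]] lt_j3]].
- by rewrite (_ : Ordinal _ = 0) //; apply: val_inj.
- by rewrite (_ : Ordinal _ = 1) //; apply: val_inj.
- by rewrite (_ : Ordinal _ = 2) //; apply: val_inj.
Qed.

Definition power_system (h : triple) (x1 x2 y1 y2 : int) : Prop :=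
  [/\ x1 + x2 - y1 - y2 = h 0,
      x1 ^+ 2 + x2 ^+ 2 - y1 ^+ 2 - y2 ^+ 2 = h 1
    & x1 ^+ 3 + x2 ^+ 3 - y1 ^+ 3 - y2 ^+ 3 = h 2].

Lemma solutionsP P h (x1 x2 y1 y2 : 'I_P.+1) :
  reflect ([/\ (0 < x1)%N, (0 < x2)%N, (0 < y1)%N & (0 < y2)%N] /\
           power_system h x1%:Z x2%:Z y1%:Z y2%:Z)
          ((x1, x2, y1, y2) \in solutions P h).
Proof.
rewrite inE; apply: (iffP and5P) => [[p1 p2 p3 p4 /forallP e]|[[p1 p2 p3 p4] e]].
  by split=> //; split; [have /eqP := e 0|have /eqP := e 1|have /eqP := e 2].
split=> //; apply/forallP => j; apply/eqP; move: j; apply/forall_ord3.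
by case: e => e1 e2 e3; split.
Qed.

(* Twelve times e2^2 - e1 e3. *)
Definition discriminant (h : triple) : int :=
  3 * (h 0 ^+ 2 - h 1) ^+ 2 - 2 * h 0 * (h 0 ^+ 3 - 3 * h 0 * h 1 + 2 * h 2).

Lemma discriminantE {h : triple} {x1 x2 y1 y2 : int} :
  power_system h x1 x2 y1 y2 ->
  discriminant h = 12 * (((x1 - y1) * (x2 - y1)) * ((x1 - y2) * (x2 - y2))).
Proof. by case=> e1 e2 e3; rewrite /discriminant -e1 -e2 -e3; ring. Qed.

(** A vanishing factor cancels one xi against one yj, and the remaining pair carries all of [h]. *)
Lemma discriminant_eq0 {P} {h : triple} {x1 x2 y1 y2 : 'I_P.+1} :
  power_system h x1%:Z x2%:Z y1%:Z y2%:Z -> discriminant h = 0 ->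
  [\/ [/\ x1 = y1, x2%:Z - y2%:Z = h 0, x2%:Z ^+ 2 - y2%:Z ^+ 2 = h 1
         & x2%:Z ^+ 3 - y2%:Z ^+ 3 = h 2],
      [/\ x2 = y1, x1%:Z - y2%:Z = h 0, x1%:Z ^+ 2 - y2%:Z ^+ 2 = h 1
         & x1%:Z ^+ 3 - y2%:Z ^+ 3 = h 2],
      [/\ x1 = y2, x2%:Z - y1%:Z = h 0, x2%:Z ^+ 2 - y1%:Z ^+ 2 = h 1
         & x2%:Z ^+ 3 - y1%:Z ^+ 3 = h 2]
    | [/\ x2 = y2, x1%:Z - y1%:Z = h 0, x1%:Z ^+ 2 - y1%:Z ^+ 2 = h 1
         & x1%:Z ^+ 3 - y1%:Z ^+ 3 = h 2]].
Proof.
move=> sys; rewrite (discriminantE sys); case: sys => <- <- <- /eqP.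
rewrite !mulf_eq0 !subr_eq0 /=.
case/orP=> /orP[] /eqP[/val_inj ->];
  [constructor 1|constructor 2|constructor 3|constructor 4];
  by split=> //; ring.
Qed.

(** * The subpolynomial bound for non-exceptional triples *)

Lemma S2_le_divisors_h1_neq0 P (h : triple) : h 0 != 0 -> discriminant h != 0 ->
  (S2 P h <= 4 * size (divisors `|discriminant h|))%N.
Proof.
set N := discriminant h => h0 N0.
rewrite S2E.
pose u (t : 'I_P.+1 * 'I_P.+1 * 'I_P.+1 * 'I_P.+1) : int :=
  2 * h 0 * t.1.2%:Z + (h 0 ^+ 2 - h 1).
pose v (t : 'I_P.+1 * 'I_P.+1 * 'I_P.+1 * 'I_P.+1) : int :=
  2 * h 0 * t.2%:Z + (h 0 ^+ 2 - h 1).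
have uv t : t \in solutions P h -> 3 * u t * v t = N.
  case: t => [[[x1 x2] y1] y2] /solutionsP[_ [e1 e2 e3]].
  by rewrite /u /v /N /discriminant -e1 -e2 -e3; exact: factorization.
(* [u] gives y1, then v = N / (3 u) gives y2, and the first two equations give {x1, x2}; the bit
   records the order of x1 and x2. *)
apply: (card_le_divisors _ _ u (fun t => (t.1.1.1 <= t.1.1.2)%N)).
- by rewrite absz_gt0.
- move=> t t' tS t'S [eu es].
  have := uv t tS; have := uv t' t'S; rewrite eu => eN' eN.
  have u0 : 3 * u t' != 0 by apply: contraNneq N0 => u0; rewrite -eN u0 mul0r.
  have ev : v t = v t' by apply: (mulfI u0); rewrite eN.
  move: eu ev es tS t'S; rewrite /u /v {uv eN eN' u0}.
  case: t => [[[x1 x2] y1] y2]; case: t' => [[[x1' x2'] y1'] y2'] /=.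
  move=> /addIr/(mulfI _) eu /addIr/(mulfI _) ev es.
  have h20 : 2 * h 0 != 0 by rewrite mulf_neq0.
  have {eu} [eu] := eu h20; have {ev} [ev] := ev h20.
  move=> /solutionsP[_ [e1 e2 _]] /solutionsP[_ [e1' e2' _]].
  have /= ey1 := val_inj eu; have /= ey2 := val_inj ev; subst y1' y2'.
  have [] := @quadratic_cases x1%:Z x2%:Z x1'%:Z x2'%:Z; [lia|lia| |].
    by move=> [[/val_inj ->] [/val_inj ->]].
  (* In the swapped case, equal order bits force x1 = x2. *)
  move=> [[a] [b]]; have c : x1 = x1' :> nat by lia.
  have d : x2 = x2' :> nat by lia.
  by rewrite (val_inj c) (val_inj d).
- move=> t tS; rewrite -(uv t tS) !abszM mulnAC.
  exact: dvdn_mull.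
Qed.

Lemma S2_le_divisors_h1_eq0 P (h : triple) : h 0 = 0 -> h 1 != 0 ->
  (S2 P h <= 4 * size (divisors `|h 1%R|))%N.
Proof.
move=> h0 h1; rewrite S2E.
pose u (t : 'I_P.+1 * 'I_P.+1 * 'I_P.+1 * 'I_P.+1) : int := t.1.2%:Z - t.1.1.1%:Z.
pose v (t : 'I_P.+1 * 'I_P.+1 * 'I_P.+1 * 'I_P.+1) : int := t.1.2%:Z - t.1.1.2%:Z.
pose s (t : 'I_P.+1 * 'I_P.+1 * 'I_P.+1 * 'I_P.+1) : int := t.1.2%:Z + t.2%:Z.
have uv t : t \in solutions P h -> 2 * u t * v t = - h 1.
  case: t => [[[x1 x2] y1] y2] /solutionsP[_ [e1 e2 _]]; rewrite -e2 /u /v /=.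
  have -> : x2%:Z = y1%:Z + y2%:Z - x1%:Z by lia.
  by ring.
(* Since x1 + x2 = y1 + y2, this common sum is fixed by [h]. *)
have sP t : t \in solutions P h -> 3 * h 1 * s t = 2 * h 2.
  case: t => [[[x1 x2] y1] y2] /solutionsP[_ [e1 e2 e3]]; rewrite -e2 -e3 /s /=.
  have -> : x2%:Z = y1%:Z + y2%:Z - x1%:Z by lia.
  by ring.
(* [u], [v] and [s] recover the ordered solution, with y1 = (u + v + s) / 2, so a constant bit
   suffices. *)
apply: (card_le_divisors _ _ u (fun=> true)).
- by rewrite absz_gt0.
- move=> t t' tS t'S [eu].
  have := uv t tS; have := uv t' t'S; rewrite eu => eN' eN.
  have u0 : 2 * u t' != 0.
    by apply: contraNneq h1 => u0; rewrite -oppr_eq0 -eN u0 mul0r.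
  have ev : v t = v t' by apply: (mulfI u0); rewrite eN.
  have es : s t = s t'.
    by apply: (@mulfI _ (3 * h 1)); rewrite ?mulf_neq0 // sP // sP.
  move: eu ev es tS t'S; rewrite /u /v /s {uv eN eN' u0 sP}.
  case: t => [[[x1 x2] y1] y2]; case: t' => [[[x1' x2'] y1'] y2'] /=.
  move=> eu ev es /solutionsP[_ [e1 _ _]] /solutionsP[_ [e1' _ _]].
  have /val_inj-> : x1 = x1' :> nat by lia.
  have /val_inj-> : x2 = x2' :> nat by lia.
  have /val_inj-> : y1 = y1' :> nat by lia.
  by have /val_inj-> : y2 = y2' :> nat by lia.
- move=> t tS; rewrite -[h 1]opprK -(uv t tS) abszN !abszM mulnAC.
  exact: dvdn_mull.
Qed.

Lemma difference_tripleP P (h : triple) (a b : 'I_P.+1) : (0 < a)%N -> (0 < b)%N ->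
  a != b -> h 0 = a%:Z - b%:Z -> h 1 = a%:Z ^+ 2 - b%:Z ^+ 2 ->
  h 2 = a%:Z ^+ 3 - b%:Z ^+ 3 -> difference_triple P h.
Proof.
move=> a0 b0 ab e1 e2 e3; exists a%:Z, b%:Z; split.
- by apply: contraNneq ab => -[/val_inj ->].
- by have := ltn_ord a; lia.
- by have := ltn_ord b; lia.
- by apply/forall_ord3; split.
Qed.

Lemma S2_le_divisors P (h : triple) : (0 < P)%N -> ~ difference_triple P h ->
  ~ zero_triple h ->
  exists2 n, (0 < n <= 12 * P ^ 4)%N & (S2 P h <= 4 * size (divisors n))%N.
Proof.
move=> P_gt0 nd nz; have [->|] := posnP (S2 P h).
  by exists 1%N; rewrite // muln_gt0 expn_gt0 P_gt0.
rewrite S2E => /card_gt0P[[[[x1 x2] y1] y2] tS].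
have /solutionsP[[p1 p2 p3 p4] esys] := tS; have [e1 e2 e3] := esys.
have dist_le (i j : 'I_P.+1) : (`|(i%:Z - j%:Z)%R| <= P)%N.
  by have := ltn_ord i; have := ltn_ord j; lia.
have [h0|h0] := eqVneq (h 0) 0.
  have e : h 1 = 2 * ((x1%:Z - y2%:Z) * - (x2%:Z - y2%:Z)).
    have ey1 : y1%:Z = x1%:Z + x2%:Z - y2%:Z by lia.
    by rewrite -e2 ey1; ring.
  (* Otherwise y2 is one of the xi, y1 is the other, and [h] vanishes. *)
  have h1 : h 1 != 0.
    apply/eqP => h1; apply: nz; apply/forall_ord3; split=> //.
    have /eqP := e; rewrite h1 eq_sym !mulf_eq0 oppr_eq0 /= !subr_eq0 -e3.
    have ey1 : y1%:Z = x1%:Z + x2%:Z - y2%:Z by lia.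
    by case/orP => /eqP e4; rewrite ey1 e4; ring.
  exists `|h 1%R|%N; last exact: S2_le_divisors_h1_eq0.
  rewrite absz_gt0 h1 e !abszM abszN /=; apply: (@leq_trans (2 * (P * P))).
    by rewrite !leq_mul.
  by rewrite mulnn leq_mul // leq_pexp2l.
have [N0|N0] := eqVneq (discriminant h) 0.
  have difference (x y : 'I_P.+1) : (0 < x)%N -> (0 < y)%N ->
      x%:Z - y%:Z = h 0 -> x%:Z ^+ 2 - y%:Z ^+ 2 = h 1 ->
      x%:Z ^+ 3 - y%:Z ^+ 3 = h 2 -> difference_triple P h.
    move=> x_gt0 y_gt0 d1 d2 d3; apply: (@difference_tripleP P h x y) => //.
    by apply: contraNneq h0 => exy; rewrite -d1 exy subrr.
  by case: nd; have [] := discriminant_eq0 esys N0 => -[_]; exact: difference.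
exists `|discriminant h|%N; last exact: S2_le_divisors_h1_neq0.
(* The discriminant is 12 times a product of four differences, each at most P in absolute value. *)
rewrite absz_gt0 N0 (discriminantE esys) /=.
by rewrite !abszM leq_mul // (expnD P 2 2) -mulnn !leq_mul.
Qed.

Lemma S2_power_bound K : exists C, forall P (h : triple), (0 < P)%N ->
  ~ difference_triple P h -> ~ zero_triple h -> (S2 P h ^ K <= C * P ^ 4)%N.
Proof.
have [C hC] := divisor_bound K; exists (4 ^ K * (C * 12))%N => P h P_gt0 nd nz.
have [n /andP[n_gt0 n_le] S2_le] := S2_le_divisors P h P_gt0 nd nz.
apply: (@leq_trans ((4 * size (divisors n)) ^ K)).
  by case: (K) => // k; rewrite leq_exp2r.
rewrite expnMn -!mulnA leq_mul2l (leq_trans (hC n n_gt0)) ?orbT //.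
by rewrite leq_mul2l n_le orbT.
Qed.

Lemma S2_subpolynomial (R : realType) (eps : R) : 0 < eps ->
  exists C : R, forall P : nat, (0 < P)%N ->
    forall h : triple, ~ difference_triple P h -> ~ zero_triple h ->
      (S2 P h)%:R <= C * P%:R `^ eps.
Proof.
move=> eps_gt0.
(* As 4 / K < eps, the K-th root of the bound C P ^ 4 is O(P ^ eps). *)
pose K := (Num.truncn (4 / eps)).+1.
have K_eps : 4 <= eps * K%:R.
  by rewrite -ler_pdivrMl // mulrC ltW // truncnS_gt.
have [C hC] := S2_power_bound K; exists C.+1%:R => P P_gt0 h nd nz.
have P_ge1 : 1 <= P%:R :> R by rewrite ler1n.
have CP_ge0 : 0 <= C.+1%:R * P%:R `^ eps :> R by rewrite mulr_ge0 // powR_ge0.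
rewrite -(@ler_pXn2r _ K) ?nnegrE ?ler0n // exprMn -!natrX.
apply: (@le_trans _ _ (C * P ^ 4)%:R); first by rewrite ler_nat hC.
rewrite natrM ler_pM ?ler0n //.
  by rewrite ler_nat (leq_trans (leqnSn C)) // -{1}[C.+1]expn1 leq_pexp2l.
by rewrite -powR_mulrn ?powR_ge0 // -powRrM natrX -powR_mulrn ?ler0n // ler_powR.
Qed.

(** * Exact counts for the zero triple and the difference triples *)

Definition posI (P : nat) : {set 'I_P.+1} := [set i : 'I_P.+1 | (0 < i)%N].

Lemma card_posI P : #|posI P| = P.
Proof.
have -> : posI P = [set~ ord0] by apply/setP => i; rewrite !inE lt0n.
by rewrite cardsC1 card_ord.
Qed.

Lemma S2_zero P (h : triple) : zero_triple h ->
  (S2 P h)%:Z = 2 * P%:Z ^+ 2 - P%:Z.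
Proof.
move=> hz; pose U := posI P.
(* By [quadratic_cases], (y1, y2) is (x1, x2) or its swap; the two families meet in the P diagonal
   solutions. *)
pose F1 := [set (p.1, p.2, p.1, p.2) | p in finset.setX U U].
pose F2 := [set (p.1, p.2, p.2, p.1) | p in finset.setX U U].
have cardF1 : #|F1| = (P * P)%N.
  by rewrite card_imset ?cardsX ?card_posI // => -[i j] [i' j'] /= [-> ->].
have cardF2 : #|F2| = (P * P)%N.
  by rewrite card_imset ?cardsX ?card_posI // => -[i j] [i' j'] /= [-> ->].
have cardI : #|F1 :&: F2| = P.
  have -> : F1 :&: F2 = [set (i, i, i, i) | i in U].
    apply/setP => t; rewrite inE; apply/andP/imsetP => [[]|[i iU ->]].
      move=> /imsetP[[i j] /= ijU ->] /imsetP[[i' j'] /= ijU' [-> -> -> _]].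
      by exists j' => //; case/setXP: ijU'.
    by split; apply/imsetP; exists (i, i) => //; apply/setXP.
  by rewrite card_imset ?card_posI // => i j [].
have -> : S2 P h = #|F1 :|: F2|.
  rewrite S2E; apply: eq_card => -[[[x1 x2] y1] y2].
  rewrite finset.in_setU; apply/solutionsP/orP => [[[p1 p2 p3 p4] [e1 e2 _]]|[]].
  - have [] := quadratic_cases x1%:Z x2%:Z y1%:Z y2%:Z.
    + by move: e1; rewrite hz; lia.
    + by move: e2; rewrite hz; lia.
    + move=> [[/val_inj ->] [/val_inj ->]]; left; apply/imsetP.
      by exists (y1, y2) => //; apply/setXP; rewrite !inE.
    + move=> [[/val_inj ->] [/val_inj ->]]; right; apply/imsetP.
      by exists (y2, y1) => //; apply/setXP; rewrite !inE.
  - move=> /imsetP[[i j] /setXP[]]; rewrite !inE => i0 j0 [-> -> -> ->].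
    by split=> //; split; rewrite hz; ring.
  - move=> /imsetP[[i j] /setXP[]]; rewrite !inE => i0 j0 [-> -> -> ->].
    by split=> //; split; rewrite hz; ring.
have := cardsUI F1 F2; rewrite cardF1 cardF2 cardI expr2.
lia.
Qed.

Lemma S2_difference P (h : triple) : difference_triple P h ->
  (S2 P h)%:Z = 4 * P%:Z - 4.
Proof.
move=> [a0 [b0 [ab0 aP bP hab]]].
have [a a_gt0 ea] : exists2 a : 'I_P.+1, (0 < a)%N & a0 = a%:Z.
  have a0_lt : (`|a0| < P.+1)%N by lia.
  by exists (Ordinal a0_lt) => /=; lia.
have [b b_gt0 eb] : exists2 b : 'I_P.+1, (0 < b)%N & b0 = b%:Z.
  have b0_lt : (`|b0| < P.+1)%N by lia.
  by exists (Ordinal b0_lt) => /=; lia.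
subst a0 b0; have ab : a <> b by move=> e; rewrite e eqxx in ab0.
have ba : b <> a by move=> e; apply: ab.
have h0 : h 0 = a%:Z - b%:Z := hab 0.
have h1 : h 1 = a%:Z ^+ 2 - b%:Z ^+ 2 := hab 1.
have h2 : h 2 = a%:Z ^+ 3 - b%:Z ^+ 3 := hab 2.
pose U := posI P.
pose F1 := [set (a, t, b, t) | t in U].
pose F2 := [set (t, a, b, t) | t in U].
pose F3 := [set (a, t, t, b) | t in U].
pose F4 := [set (t, a, t, b) | t in U].
(* As a and b differ, F1 is disjoint from F4 and F2 from F3, so one inclusion-exclusion between the
   two unions remains. *)
have card14 : #|F1 :|: F4| = (2 * P)%N.
  rewrite cardsU (_ : F1 :&: F4 = finset.set0) ?finset.cards0 ?subn0.
    by rewrite !card_imset ?card_posI ?mul2n ?addnn // => i j [].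
  apply/setP => t; rewrite !inE; apply/negbTE/negP.
  move=> /andP[/imsetP[i _ ->] /imsetP[j _ []]].
  by move=> <- _ /esym.
have card23 : #|F2 :|: F3| = (2 * P)%N.
  rewrite cardsU (_ : F2 :&: F3 = finset.set0) ?finset.cards0 ?subn0.
    by rewrite !card_imset ?card_posI ?mul2n ?addnn // => i j [].
  apply/setP => t; rewrite !inE; apply/negbTE/negP.
  move=> /andP[/imsetP[i _ ->] /imsetP[j _ []]].
  by move=> _ <- /esym.
have cardI : #|(F1 :|: F4) :&: (F2 :|: F3)| = 4%N.
  pose s := [:: (a, a, b, a); (a, b, b, b); (b, a, b, b); (a, a, a, b)].
  have us : uniq s.
    rewrite /s /= !inE !xpair_eqE !eqxx.
    have /eqP/negbTE -> := ab; have /eqP/negbTE -> := ba.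
    by rewrite ?andbF.
  have card_s : #|s| = 4%N by apply/card_uniqP.
  rewrite -card_s; apply: eq_card => t.
  have aU : a \in U by rewrite inE.
  have bU : b \in U by rewrite inE.
  rewrite /s !inE; apply/andP/idP => [[]|].
    move=> /orP[] /imsetP[i iU ->] /orP[] /imsetP[j jU []].
    - by move=> <- -> _; rewrite eqxx.
    - by move=> -> <- _; rewrite eqxx orbT.
    - by move=> <- -> _; rewrite eqxx !orbT.
    - by move=> -> <- _; rewrite eqxx !orbT.
  move=> /or4P[] /eqP ->; split; apply/orP.
  - by left; apply/imsetP; exists a.
  - by left; apply/imsetP; exists a.
  - by left; apply/imsetP; exists b.
  - by right; apply/imsetP; exists b.
  - by right; apply/imsetP; exists b.
  - by left; apply/imsetP; exists b.
  - by right; apply/imsetP; exists a.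
  - by right; apply/imsetP; exists a.
have -> : S2 P h = #|(F1 :|: F4) :|: (F2 :|: F3)|.
  rewrite S2E; apply: eq_card => -[[[x1 x2] y1] y2].
  apply/idP/idP; last first.
    rewrite !finset.in_setU => /orP[] /orP[] /imsetP[i]; rewrite inE => i0 [-> -> -> ->];
      by apply/solutionsP; split=> //; split; rewrite ?h0 ?h1 ?h2; ring.
  move=> tS; have /solutionsP[[p1 p2 p3 p4] esys] := tS.
  (* The nonzero difference and the difference of squares give the sum, hence both numbers. *)
  have cancel (x y : 'I_P.+1) : x%:Z - y%:Z = h 0 ->
      x%:Z ^+ 2 - y%:Z ^+ 2 = h 1 -> x = a /\ y = b.
    rewrite h0 h1 => e e'.
    have e'' : x%:Z + y%:Z = a%:Z + b%:Z.
      apply: (@mulfI _ (a%:Z - b%:Z)); first by apply/eqP => /subr0_eq[/val_inj].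
      by rewrite -{1}e -!subr_sqr.
    have /val_inj -> : x = a :> nat by lia.
    by have /val_inj -> : y = b :> nat by lia.
  (* Evaluated at the solution (a, b, b, b), which has a cancelling pair. *)
  have N0 : discriminant h = 0.
    rewrite (@discriminantE h a%:Z b%:Z b%:Z b%:Z).
      by rewrite subrr !(mulr0, mul0r).
    by split; rewrite ?h0 ?h1 ?h2; ring.
  have i0 (i : 'I_P.+1) : (0 < i)%N -> i \in U by rewrite inE.
  rewrite !finset.in_setU.
  have [] := discriminant_eq0 esys N0 => -[-> d1 d2 _];
    have [-> ->] := cancel _ _ d1 d2; apply/orP.
  - by left; apply/orP; right; apply/imsetP; exists y1; rewrite ?i0.
  - by right; apply/orP; right; apply/imsetP; exists y1; rewrite ?i0.
  - by right; apply/orP; left; apply/imsetP; exists y2; rewrite ?i0.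
  - by left; apply/orP; left; apply/imsetP; exists y2; rewrite ?i0.
have := cardsUI (F1 :|: F4) (F2 :|: F3); rewrite card14 card23 cardI.
by lia.
Qed.

(** * Classification of the triples with many solutions *)

Theorem theorem1p1 (R : realType) :
  (forall eta : R, 0 < eta < 1 ->
     exists P0 : nat, forall P : nat, (0 < P)%N -> (P0 <= P)%N ->
       forall h : triple, P%:R `^ eta < (S2 P h)%:R ->
         (difference_triple P h /\ (S2 P h)%:Z = 4 * P%:Z - 4)
         \/ (zero_triple h /\ (S2 P h)%:Z = 2 * P%:Z ^+ 2 - P%:Z))
  /\
  (forall eps : R, 0 < eps ->
     exists C : R, forall P : nat, (0 < P)%N ->
       forall h : triple, ~ difference_triple P h -> ~ zero_triple h ->
         (S2 P h)%:R <= C * P%:R `^ eps).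
Proof.
split=> [eta /andP[eta_gt0 _]|]; last exact: S2_subpolynomial.
have eta2_gt0 : 0 < eta / 2 by rewrite divr_gt0.
have [C hC] := @S2_subpolynomial R _ eta2_gt0.
(* Beyond this threshold C <= P ^ (eta / 2), so the bound C P ^ (eta / 2) is at most P ^ eta,
   against [S2_gt]. *)
exists (Num.truncn (`|C| `^ (2 / eta))).+1 => P P_gt0 P_ge h S2_gt.
have [zh|nz] := pselect (zero_triple h); first by right; split; last exact: S2_zero.
have [dh|nd] := pselect (difference_triple P h).
  by left; split; last exact: S2_difference.
have C_le : C <= P%:R `^ (eta / 2).
  apply: (le_trans (ler_norm C)).
  have -> : `|C| = (`|C| `^ (2 / eta)) `^ (eta / 2).
    rewrite -powRrM (_ : 2 / eta * (eta / 2) = 1) ?powRr1 //.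
    by field; rewrite gt_eqF.
  apply: ge0_ler_powR; rewrite ?nnegrE ?powR_ge0 ?ler0n ?(ltW eta2_gt0) //.
  by apply: (le_trans (ltW (truncnS_gt _))); rewrite ler_nat.
have := lt_le_trans S2_gt (hC P P_gt0 h nd nz); rewrite ltNge => /negP[].
have {2}-> : eta = eta / 2 + eta / 2 by field.
rewrite powRD ?ler_wpM2r ?powR_ge0 //.
by rewrite pnatr_eq0 -lt0n P_gt0 implybT.
Qed.
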